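(* There is an algorithm $\mathcal{A}$ such that for any $w$-element poset $(W,\le)$ and any $k\in[w]$, the $N$ many $k$-element order ideals of $(W,\le)$ get enumerated by $\mathcal{A}$ in output-polynomial time $O(Nw^3)$.
   Context: $[w]=\{1,2,\dots,w\}$. An order ideal of a poset $(W,\le)$ is a subset $X\subseteq W$ such that $p\in X$ and $q\le p$ imply $q\in X$. To enumerate a collection of sets means to produce (list) all of them, one by one. The poset is given, say, by a $w\times w$ incidence matrix of $\le$. The constant implied by $O(\cdot)$ is independent of the poset, $w$ and $k$. *)

(* Defs.v *)
From mathcomp Require Import all_boot all_order.

Set Implicit Arguments.
Unset Strict Implicit.
Unset Printing Implicit Defensive.

(** Algorithms are programs for the random access machine of Cook and Reckhow,
    under the uniform cost criterion. The registers X_0, X_1, ... contain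
    natural numbers, so subtraction is truncated; multiplication is not a
    primitive. *)

Inductive instr : Type :=
  | SetConst of nat & nat         (* SetConst i n   :  X_i <- n             *)
  | SetAdd of nat & nat & nat     (* SetAdd i j l   :  X_i <- X_j + X_l     *)
  | SetSub of nat & nat & nat     (* SetSub i j l   :  X_i <- X_j - X_l     *)
  | Fetch of nat & nat            (* Fetch i j      :  X_i <- X_(X_j)       *)
  | Store of nat & nat            (* Store i j      :  X_(X_i) <- X_j       *)
  | JumpPos of nat & nat          (* JumpPos j m    :  goto m if X_j > 0    *)
  | Read of nat                   (* Read i         :  X_i <- next input    *)
  | Write of nat.                 (* Write i        :  output X_i           *)

Definition program := seq instr.

Record config := Config {
  pc : nat;
  reg : nat -> nat;
  inp : seq nat;
  out : seq nat }.

(** Reading from an exhausted input tape yields 0. *)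
Definition exec (a : instr) (c : config) : config :=
  let: Config p X s o := c in
  match a with
  | SetConst i n => Config p.+1 [eta X with i |-> n] s o
  | SetAdd i j l => Config p.+1 [eta X with i |-> X j + X l] s o
  | SetSub i j l => Config p.+1 [eta X with i |-> X j - X l] s o
  | Fetch i j => Config p.+1 [eta X with i |-> X (X j)] s o
  | Store i j => Config p.+1 [eta X with X i |-> X j] s o
  | JumpPos j m => Config (if 0 < X j then m else p.+1) X s o
  | Read i => Config p.+1 [eta X with i |-> head 0 s] (behead s) o
  | Write i => Config p.+1 X s (rcons o (X i))
  end.

(** A configuration whose program counter is outside the program is halted. *)
Definition halted (A : program) (c : config) : bool := size A <= pc c.

Definition step (A : program) (c : config) : config :=
  if onth A (pc c) is Some a then exec a c else c.

Definition start (x : seq nat) : config := Config 0 (fun=> 0) x [::].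

Definition outputs_within (A : program) (x : seq nat) (T : nat) (y : seq nat) :
    Prop :=
  exists2 t, t <= T &
    let c := iter t (step A) (start x) in halted A c /\ out c = y.

Section Ideals.

Variables (d : Order.disp_t) (W : finPOrderType d).
Implicit Type X : {set W}.

Definition order_ideal X : bool :=
  [forall p in X, forall q, (q <= p)%O ==> (q \in X)].

Definition ideals_of_card (k : nat) : {set {set W}} :=
  [set X | order_ideal X & #|X| == k].

(** The machine knows the elements of [W] only through a numbering [lab] by
    0, ..., w - 1. *)
Variables (w : nat) (lab : 'I_w -> W).

(** w and k, followed by the incidence matrix of the order, row by row. *)
Definition encode_input (k : nat) : seq nat :=
  [:: w, k & [seq nat_of_bool (lab i <= lab j)%O | i <- enum 'I_w, j <- enum 'I_w]].

(** The numbers of the elements of [X], in increasing order. *)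
Definition encode_set X : seq nat :=
  [seq val i | i <- enum 'I_w & lab i \in X].

Definition encode_listing (s : seq {set W}) : seq nat :=
  flatten [seq encode_set X | X <- s].

End Ideals.

Definition listing_of (T : finType) (s : seq T) (F : {set T}) : Prop :=
  uniq s /\ s =i F.

(* Main.v *)
Require Import Defs.
From mathcomp Require Import all_boot all_order.
From mathcomp Require Import zify.

Set Implicit Arguments.
Unset Strict Implicit.
Unset Printing Implicit Defensive.

(** A prefix u of a 0-1 vector fixes, for an initial segment of the labels,
    which elements are in and which are out. It extends to the characteristic
    vector of a k-element order ideal if and only if the down-set I generated by
    the elements that are in and the up-set O generated by those that are out
    satisfy I n O = 0, |I| <= k and |O| <= w - k: a maximal chain of order
    ideals from I to the complement of O then contains one of size k. This is
    tested in time O(w^2), so the backtracking search that cuts off the non-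
    extendable prefixes has at most 2w+1 nodes per leaf, each of cost O(w^2),
    and its leaves are the order ideals to be listed. *)

(** * Hoare-style rules for relocatable program fragments *)

(** Overriding the program counter lets pre- and postconditions speak of registers and tapes only,
    whatever the address of the code. *)
Definition at_pc (p : nat) (c : config) : config :=
  Config p (reg c) (inp c) (out c).

(** A program, depending on the address at which it is placed. *)
Definition fragment := nat -> program.

(** Total correctness of [b] within [T] steps, wherever [b] is placed. *)
Definition runs (b : fragment) (T : nat) (c : config) (Q : config -> Prop) :
    Prop :=
  forall l r, exists t c',
    [/\ t <= T, Q c' &
        iter t (step (l ++ b (size l) ++ r)) (at_pc (size l) c)
        = at_pc (size (l ++ b (size l))) c'].

Definition block (l : seq instr) : fragment := fun=> l.
Definition chain (b1 b2 : fragment) : fragment :=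
  fun p => b1 p ++ b2 (p + size (b1 p)).
Definition unless (j : nat) (b : fragment) : fragment :=
  fun p => JumpPos j (p.+1 + size (b p.+1)) :: b p.+1.
(** The body is executed at least once, and again as long as register [j] is
    positive. *)
Definition repeat (b : fragment) (j : nat) : fragment :=
  fun p => rcons (b p) (JumpPos j p).

Notation "b1 ;; b2" := (chain b1 b2) (at level 60, right associativity).

Definition straight (a : instr) : bool :=
  if a is JumpPos _ _ then false else true.

Lemma onth_mid T (l : seq T) x r : onth (l ++ x :: r) (size l) = Some x.
Proof. by elim: l. Qed.

Lemma exec_at a p c :
  straight a -> exec a (at_pc p c) = at_pc p.+1 (exec a c).
Proof. by case: c => q X s o; case: a. Qed.

Lemma step_at A a p c :
  straight a -> onth A p = Some a ->
  step A (at_pc p c) = at_pc p.+1 (exec a c).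
Proof. by move=> sa ap; rewrite /step -[pc _]/p ap exec_at. Qed.

Lemma runs_weaken b T T' c (Q Q' : config -> Prop) :
  T <= T' -> (forall c', Q c' -> Q' c') -> runs b T c Q -> runs b T' c Q'.
Proof.
move=> leT QQ' H l r; have [t [c' [tT Qc E]]] := H l r.
by exists t, c'; split; [exact: leq_trans leT | exact: QQ' |].
Qed.

Lemma runs_leq b T T' c Q : runs b T c Q -> T <= T' -> runs b T' c Q.
Proof. by move=> H le; apply: runs_weaken H. Qed.

Lemma runs_block l c Q :
  all straight l -> Q (foldl (fun c a => exec a c) c l) ->
  runs (block l) (size l) c Q.
Proof.
move=> sl Qc l0 r; exists (size l), (foldl (fun c a => exec a c) c l).
split=> //; rewrite /block; elim: l l0 c sl {Qc} => [|a l IH] l0 c /=.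
  by rewrite cats0.
case/andP=> sa sl; rewrite -iterS iterSr (step_at _ sa (onth_mid _ _ _)).
have := IH (rcons l0 a) (exec a c) sl.
by rewrite !cat_rcons size_rcons.
Qed.

Lemma runs_chain b1 b2 T1 T2 c Q :
  runs b1 T1 c (fun c' => runs b2 T2 c' Q) -> runs (b1 ;; b2) (T1 + T2) c Q.
Proof.
move=> H l r.
have [t1 [c1 [t1T H2 E1]]] := H l (b2 (size l + size (b1 (size l))) ++ r).
have [t2 [c2 [t2T Q2 E2]]] := H2 (l ++ b1 (size l)) r.
exists (t1 + t2), c2; split=> //; first exact: leq_add.
rewrite addnC iterD /chain -catA E1.
by move: E2; rewrite size_cat -!catA => ->.
Qed.

Lemma runs_unless j b T c (Q : config -> Prop) :
  (0 < reg c j -> Q c) -> (reg c j = 0 -> runs b T c Q) ->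
  runs (unless j b) T.+1 c Q.
Proof.
move=> Qpos Qzero l r; rewrite /unless.
set a := JumpPos _ _; set B := b _.
have stepE : step (l ++ (a :: B) ++ r) (at_pc (size l) c) =
    at_pc (if 0 < reg c j then (size l).+1 + size B else (size l).+1) c.
  by rewrite /step /= onth_mid.
case: (posnP (reg c j)) stepE => [j0 | jpos] stepE.
  have [t [c' [tT Qc E]]] := Qzero j0 (rcons l a) r.
  exists t.+1, c'; split=> //.
  by rewrite iterSr stepE; move: E; rewrite size_rcons !cat_rcons.
exists 1, c; split=> //; first exact: Qpos.
by rewrite /= stepE size_cat /= addnS addSn.
Qed.

(** One unrolling of the loop. The remaining iterations sit in the postcondition of the body, so the
    rule suits an induction on a counter as well as one on a search tree. The extra step is the
    jump. *)
Lemma runs_repeat b j T1 T2 c Q :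
  runs b T1 c (fun c' =>
    if 0 < reg c' j then runs (repeat b j) T2 c' Q else Q c') ->
  runs (repeat b j) (T1.+1 + T2) c Q.
Proof.
move=> H l r; rewrite {1 2}/repeat.
set B := b (size l).
have [t1 [c1 [t1T H2 E1]]] := H l (JumpPos j (size l) :: r).
set A := l ++ rcons B _ ++ r.
have AE : A = l ++ B ++ JumpPos j (size l) :: r by rewrite /A cat_rcons.
have stepE : step A (at_pc (size (l ++ B)) c1) =
    at_pc (if 0 < reg c1 j then size l else (size (l ++ B)).+1) c1.
  by rewrite /step AE /= catA onth_mid.
rewrite -/B -AE in E1.
case: (posnP (reg c1 j)) stepE H2 => [j0 | jpos] stepE H2.
  exists t1.+1, c1; split=> //; first by rewrite ltnS (leq_trans t1T) ?leq_addr.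
  by rewrite iterS E1 stepE -rcons_cat size_rcons.
have [t2 [c2 [t2T Q2 E2]]] := H2 l r.
exists (t1.+1 + t2), c2; split=> //; first exact: leq_add.
by rewrite addnC iterD iterS E1 stepE E2.
Qed.

Lemma runs_count (Inv : nat -> config -> Prop) n b j T c :
  0 < n ->
  (forall i c, i < n -> Inv i c -> reg c j = n - i ->
     runs b T c (fun c' => Inv i.+1 c' /\ reg c' j = n - i.+1)) ->
  Inv 0 c -> reg c j = n -> runs (repeat b j) (T.+1 * n) c (Inv n).
Proof.
move=> n0 Hb Inv0 cj.
(* Induction on m, where m + 1 iterations are left. *)
suff H m i c1 : i + m.+1 = n -> Inv i c1 -> reg c1 j = m.+1 ->
    runs (repeat b j) (T.+1 * m.+1) c1 (Inv n).
  by have := H n.-1 0 c; rewrite prednK // => /(_ (add0n n) Inv0 cj).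
elim: m i c1 => [|m IH] i c1 imn Invi c1j; rewrite mulnS; apply: runs_repeat.
all: have cji : reg c1 j = n - i by rewrite c1j -imn addKn.
all: have ltin : i < n by rewrite -imn addnS ltnS leq_addr.
all: apply: runs_weaken (leqnn _) _ (Hb i c1 ltin Invi cji) => c2 [Invi1 c2j].
all: rewrite -imn addnS subSS addKn in c2j; rewrite c2j //=.
  by move: Invi1; rewrite -imn addn1.
by apply: IH Invi1 c2j; rewrite addSnnS.
Qed.

Lemma runs_outputs (b : fragment) x T y :
  runs b T (start x) (fun c => out c = y) -> outputs_within (b 0) x T y.
Proof.
move=> /(_ [::] [::]) [t [c [tT outc E]]]; exists t => //.
move: E; rewrite /= cats0 /start /at_pc /= => ->.
by rewrite /halted /=.
Qed.

(** * Memory layout and symbolic execution of straight-line code *)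

(** Memory layout: registers below [base] are scalars; the w * w matrix entries
    start at [base], and the w digits of the current prefix follow them, from
    address [Rbeg] to address [Rend]. [Rcur] is the address of the first
    undecided digit. [Rmode] is 1 if the prefix has yet to be explored and 0 if
    its subtree is finished. *)
Local Notation Rzero := 0 (only parsing).
Local Notation Rone := 1 (only parsing).
Local Notation Rtwo := 2 (only parsing).
Local Notation Rw := 3 (only parsing).
Local Notation Rk := 4 (only parsing).
Local Notation Rbeg := 5 (only parsing).
Local Notation Rend := 6 (only parsing).
Local Notation Rcur := 7 (only parsing).
Local Notation Rmode := 8 (only parsing).
Local Notation Rold := 9 (only parsing).
Local Notation Ractive := 10 (only parsing).
Local Notation Rflag := 11 (only parsing).
Local Notation Rcount := 12 (only parsing).
Local Notation Rnin := 13 (only parsing).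
Local Notation Rnout := 14 (only parsing).
Local Notation Rfail := 15 (only parsing).
Local Notation Rtmp := 16 (only parsing).
Local Notation Rsum := 17 (only parsing).
Local Notation Rcount2 := 20 (only parsing).
Local Notation Rrow := 21 (only parsing).
Local Notation Rcol := 22 (only parsing).
Local Notation Rdig := 23 (only parsing).
Local Notation Rin := 24 (only parsing).
Local Notation Rout := 25 (only parsing).
Local Notation Rdigit := 26 (only parsing).
Local Notation Rval := 27 (only parsing).
Local Notation Raux := 28 (only parsing).
Local Notation base := 32 (only parsing).

(** Inner routines use scalars with larger numbers, so n tells which scalars survive: [scan] keeps
    those below 20, [check] and [print] those below 12. *)
Definition frame (n : nat) (X X' : nat -> nat) : Prop :=
  forall a, (a < n) || (base <= a) -> X' a = X a.

(** The value of register [r] after executing the reversal of [l] from the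
    registers [X], provided that all the instructions in [l] write into
    registers below [base] and all the fetches read registers above it. *)
Fixpoint value (X : nat -> nat) (l : seq instr) (r : nat) : nat :=
  if l is a :: l then
    match a with
    | SetConst i n => if r == i then n else value X l r
    | SetAdd i j m => if r == i then value X l j + value X l m else value X l r
    | SetSub i j m => if r == i then value X l j - value X l m else value X l r
    | Fetch i j => if r == i then X (value X l j) else value X l r
    | _ => value X l r
    end
  else X r.

(** As the writes stay below [base], a fetch from [base] or above sees an initial register; this
    justifies the lookup in [X] made by [value]. *)
Fixpoint safe (X : nat -> nat) (l : seq instr) : bool :=
  if l is a :: l then
    (if a is Fetch _ j then base <= value X l j else true) && safe X l
  else true.

Definition writes_in (n : nat) (a : instr) : bool :=
  match a with
  | SetConst i _ | SetAdd i _ _ | SetSub i _ _ | Fetch i _ => n <= i < base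
  | _ => false
  end.

Lemma frame_value n X l :
  all (writes_in n) l -> frame n X (value X l).
Proof.
elim: l => [|a l IH] //= /andP[aw /IH lw] r rn.
case: a aw => //= i *; rewrite (lw r rn) ifN_eq //; lia.
Qed.

Lemma value_exec n X l a c :
  all (writes_in n) l -> writes_in n a -> safe X (a :: l) ->
  reg c =1 value X l -> reg (exec a c) =1 value X (a :: l).
Proof.
move=> lw aw /= /andP[sa _]; case: c => [p Y s o] /= E r.
case: a aw sa => //= [i m|i j m|i j m|i j] aw sa; rewrite !E //.
by case: eqP => // _; rewrite (@frame_value n _ _ lw) // sa orbT.
Qed.

Lemma safe_catrev X l1 l2 : safe X (catrev l1 l2) -> safe X l2.
Proof. by elim: l1 l2 => //= a l1 IH l2 /IH /andP[]. Qed.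

Lemma value_foldl n X l l0 c :
  all (writes_in n) l0 -> all (writes_in n) l -> safe X (catrev l l0) ->
  reg c =1 value X l0 ->
  let c' := foldl (fun c a => exec a c) c l in
  [/\ inp c' = inp c, out c' = out c & reg c' =1 value X (catrev l l0)].
Proof.
elim: l l0 c => [|a l IH] l0 c //= l0w /andP[aw lw] sl E.
have l0w' : all (writes_in n) (a :: l0) by rewrite /= aw.
have [-> -> Er] := IH _ _ l0w' lw sl (value_exec l0w aw (safe_catrev sl) E).
by split=> //; case: c {E Er} => p Y s o; case: a aw {sl l0w'}.
Qed.

(** The rule for all arithmetic blocks: [value] computes by simplification, and the frame condition
    takes care of everything the block does not touch. *)
Lemma runs_pure n l c (Q : config -> Prop) :
  all (writes_in n) l -> safe (reg c) (catrev l [::]) ->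
  (forall c', inp c' = inp c -> out c' = out c -> frame n (reg c) (reg c') ->
     reg c' =1 value (reg c) (catrev l [::]) -> Q c') ->
  runs (block l) (size l) c Q.
Proof.
move=> lw sl H; apply: runs_block; first by apply: sub_all lw => -[].
have [//|Ei Eo Er] := @value_foldl n (reg c) l [::] c isT lw sl.
apply: H => // a an.
by rewrite Er (@frame_value n) // catrevE all_cat all_rev lw.
Qed.

Lemma runs_store i j c (Q : config -> Prop) :
  (forall c', inp c' = inp c -> out c' = out c ->
     reg c' (reg c i) = reg c j ->
     (forall a, a != reg c i -> reg c' a = reg c a) -> Q c') ->
  runs (block [:: Store i j]) 1 c Q.
Proof.
move=> H; apply: runs_block => //; case: c H => p X s o /= H.
by apply: H => //= [|a ai]; rewrite ?eqxx // ifN_eq.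
Qed.

Lemma runs_read i c (Q : config -> Prop) :
  (forall c', inp c' = behead (inp c) -> out c' = out c ->
     (forall a, reg c' a = if a == i then head 0 (inp c) else reg c a) ->
     Q c') ->
  runs (block [:: Read i]) 1 c Q.
Proof. by move=> H; apply: runs_block => //; apply: H => //; case: c. Qed.

Lemma runs_write i c (Q : config -> Prop) :
  (forall c', inp c' = inp c -> out c' = rcons (out c) (reg c i) ->
     reg c' =1 reg c -> Q c') ->
  runs (block [:: Write i]) 1 c Q.
Proof. by move=> H; apply: runs_block => //; apply: H => //; case: c. Qed.

(** * The program *)

(** On bits and digits, [M + x - 2] is the truth value of [M && (x == 2)], and
    [M - (x - 1) - (1 - x)] that of [M && (x == 1)]. *)
Definition scan_body : fragment := block
  [:: Fetch Rdigit Rdig; Fetch Rval Rrow; SetAdd Rval Rval Rdigit;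
      SetSub Rval Rval Rtwo; SetAdd Rin Rin Rval;
      Fetch Rval Rcol; SetSub Raux Rdigit Rone; SetSub Rval Rval Raux;
      SetSub Raux Rone Rdigit; SetSub Rval Rval Raux; SetAdd Rout Rout Rval;
      SetAdd Rrow Rrow Rone; SetAdd Rcol Rcol Rw;
      SetAdd Rdig Rdig Rone; SetSub Rcount2 Rcount2 Rone].

Definition scan : fragment := repeat scan_body Rcount2.

(** [1 - (1 - n)] is the truth value of [0 < n]. *)
Definition check_body : fragment :=
  block [:: SetAdd Rcount2 Rw Rzero; SetAdd Rcol Rtmp Rzero;
            SetAdd Rdig Rbeg Rzero; SetConst Rin 0; SetConst Rout 0] ;;
  scan ;;
  block [:: SetSub Rin Rone Rin; SetSub Rin Rone Rin; SetAdd Rnin Rnin Rin;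
            SetSub Rout Rone Rout; SetSub Rout Rone Rout;
            SetAdd Rnout Rnout Rout;
            SetAdd Rin Rin Rout; SetSub Rin Rin Rone; SetAdd Rfail Rfail Rin;
            SetAdd Rtmp Rtmp Rone; SetSub Rcount Rcount Rone].

Definition check : fragment :=
  block [:: SetAdd Rcount Rw Rzero; SetConst Rnin 0; SetConst Rnout 0;
            SetConst Rfail 0; SetConst Rtmp base; SetConst Rrow base] ;;
  repeat check_body Rcount ;;
  block [:: SetSub Rnin Rnin Rk; SetAdd Rfail Rfail Rnin;
            SetAdd Rnout Rnout Rk; SetSub Rnout Rnout Rw;
            SetAdd Rfail Rfail Rnout].

Definition print_body : fragment :=
  block [:: Fetch Rdigit Rdig; SetSub Rdigit Rtwo Rdigit] ;;
  unless Rdigit (block [:: Write Rnin]) ;;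
  block [:: SetAdd Rnin Rnin Rone; SetAdd Rdig Rdig Rone;
            SetSub Rcount Rcount Rone].

Definition print : fragment :=
  block [:: SetAdd Rcount Rw Rzero; SetAdd Rdig Rbeg Rzero; SetConst Rnin 0] ;;
  repeat print_body Rcount.

(** If the prefix has an extension and is not full, append the digit 2;
    otherwise the digit 0 is written over an undecided digit or at [Rend]. *)
Definition down : fragment :=
  check ;;
  block [:: SetSub Rtmp Rend Rcur; SetAdd Rsum Rfail Rtmp] ;;
  unless Rsum print ;;
  block [:: SetSub Rtmp Rone Rtmp; SetSub Rtmp Rone Rtmp;
            SetSub Rtmp Rtmp Rfail;
            SetAdd Rsum Rtmp Rtmp] ;;
  block [:: Store Rcur Rsum] ;;
  block [:: SetAdd Rcur Rcur Rtmp; SetAdd Rmode Rtmp Rzero].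

(** Turn the last digit 2 into 1, or erase the last digit 1. *)
Definition up : fragment :=
  block [:: SetSub Rcur Rcur Rone; Fetch Rtmp Rcur; SetSub Rmode Rtmp Rone] ;;
  block [:: Store Rcur Rmode] ;;
  block [:: SetAdd Rcur Rcur Rmode].

Definition search_body : fragment :=
  block [:: SetAdd Rold Rmode Rzero; SetSub Rflag Rone Rmode] ;;
  unless Rflag down ;;
  unless Rold up ;;
  block [:: SetSub Ractive Rcur Rbeg; SetAdd Ractive Ractive Rmode].

Definition search : fragment := repeat search_body Ractive.

Definition read_row_body : fragment :=
  block [:: Read Rtmp] ;;
  block [:: Store Rbeg Rtmp] ;;
  block [:: SetAdd Rbeg Rbeg Rone; SetSub Rcount2 Rcount2 Rone].

Definition read_body : fragment :=
  block [:: SetAdd Rcount2 Rw Rzero] ;;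
  repeat read_row_body Rcount2 ;;
  block [:: SetSub Rcount Rcount Rone].

Definition read_input : fragment :=
  block [:: Read Rw] ;;
  block [:: Read Rk] ;;
  block [:: SetConst Rone 1; SetConst Rtwo 2; SetConst Rbeg base;
            SetAdd Rcount Rw Rzero] ;;
  repeat read_body Rcount ;;
  block [:: SetAdd Rend Rbeg Rw; SetAdd Rcur Rbeg Rzero; SetConst Rmode 1;
            SetConst Ractive 1].

Definition ideal_lister : fragment := read_input ;; search.

(** * The memory invariant and the correctness of the subroutines *)

Lemma frame_trans n m X X' X'' :
  m <= n -> frame m X X' -> frame n X' X'' -> frame m X X''.
Proof.
move=> mn H H' a ha; rewrite H' ?H //.
by case/orP: ha => [ha|->]; rewrite ?orbT // (leq_trans ha mn).
Qed.

(** The digits are 2 for in, 1 for out and 0 for undecided. *)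
Definition digit (u : seq bool) (p : nat) : nat :=
  nth 0 [seq (nat_of_bool b).+1 | b <- u] p.

Section Machine.

Variables (w k : nat) (M : nat -> nat -> nat).
Implicit Types (u : seq bool) (c : config) (X : nat -> nat).

Definition memory u X : Prop :=
  [/\ [/\ X Rzero = 0, X Rone = 1, X Rtwo = 2, X Rw = w & X Rk = k],
      X Rbeg = base + w * w, X Rend = base + w * w + w,
      forall q p, q < w -> p < w -> X (base + q * w + p) = M q p &
      forall p, p < w -> X (base + w * w + p) = digit u p].

Lemma memory_frame n u X X' :
  7 <= n -> frame n X X' -> memory u X -> memory u X'.
Proof.
move=> n7 XX' [[h0 h1 h2 h3 h4] h5 h6 hM hx].
have fr a : a < 7 -> X' a = X a by move=> a7; rewrite XX' // (leq_trans a7 n7).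
split; first by rewrite !fr.
- by rewrite fr.
- by rewrite fr.
- by move=> q p qw pw; rewrite XX' ?hM // -addnA leq_addr orbT.
- by move=> p pw; rewrite XX' ?hx // -addnA leq_addr orbT.
Qed.

(** For the incidence matrix of an order, these are the truth values of: p is in and q <= p; p is
    out and p <= q. A nonzero value shows that q belongs to the down-set I, respectively to the
    up-set O. *)
Definition below u q p := M q p + digit u p - 2.
Definition above u q p := M p q - (digit u p - 1) - (1 - digit u p).

Lemma runs_scan u q c :
  q < w -> memory u (reg c) -> reg c Rcount2 = w -> reg c Rrow = base + q * w ->
  reg c Rcol = base + q -> reg c Rdig = base + w * w ->
  runs scan (16 * w) c (fun c' =>
    [/\ frame 20 (reg c) (reg c'), out c' = out c,
        reg c' Rrow = base + q * w + w,
        reg c' Rin = reg c Rin + \sum_(p < w) below u q p &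
        reg c' Rout = reg c Rout + \sum_(p < w) above u q p]).
Proof.
move=> qw mem hn hr hl hd.
pose Inv i c' := [/\ frame 20 (reg c) (reg c'), out c' = out c,
  [/\ reg c' Rrow = base + q * w + i, reg c' Rcol = base + i * w + q &
      reg c' Rdig = base + w * w + i],
  reg c' Rin = reg c Rin + \sum_(p < i) below u q p &
  reg c' Rout = reg c Rout + \sum_(p < i) above u q p].
apply: (@runs_weaken _ (16 * w) _ _ (Inv w)) => // [c' [? ? [? _ _] ? ?] //|].
apply: (@runs_count Inv); first by lia.
2: by split; rewrite ?big_ord0 ?addn0 // mul0n addn0.
2: by [].
move=> i {hr hl hd hn}c1 iw [fr eo [hr hl hd] ei eu] hc.
have [[h0 h1 h2 h3 h4] h5 h6 hM hx] := @memory_frame 20 u _ _ isT fr mem.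
have Ex := hx _ iw; have Eq := hM _ _ qw iw; have Ep := hM _ _ iw qw.
apply: (@runs_pure 20) => //=; first by rewrite hr hl hd -!addnA.
move=> c2 _ eo2 fr2 val; split; last by rewrite val /= hc h1; lia.
split; rewrite ?eo2 //.
- exact: frame_trans fr fr2.
- by rewrite !val /= hr hl hd h1 h3; split; lia.
- by rewrite val /= hr hd Ex Eq h2 ei big_ord_recr addnA.
- by rewrite val /= hl hd Ex Ep h1 eu big_ord_recr addnA.
Qed.

Definition is_in u q := 0 < \sum_(p < w) below u q p.
Definition is_out u q := 0 < \sum_(p < w) above u q p.
(** Each of the three truncated differences vanishes exactly when one of the conditions I n O = 0,
    |I| <= k, |O| <= w - k holds. *)
Definition failure u :=
  \sum_(q < w) (is_in u q + is_out u q - 1) +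
  (\sum_(q < w) is_in u q - k) + (\sum_(q < w) is_out u q + k - w).

Hypothesis w_gt0 : 0 < w.

Lemma sub1_sub1 n : 1 - (1 - n) = (0 < n).
Proof. by case: n => // n; rewrite subSS sub0n. Qed.

Lemma runs_check u c : memory u (reg c) ->
  runs check (28 * (w * w) + 17 * w) c (fun c' =>
    [/\ frame 12 (reg c) (reg c'), out c' = out c & reg c' Rfail = failure u]).
Proof.
move=> mem; have [[h0 h1 h2 h3 h4] h5 h6 hM hx] := mem.
(* The exact time is accumulated in a unification variable and compared with the stated bound in the
   last goal. *)
eapply runs_leq.
apply: runs_chain.
apply: (@runs_pure 12) => //= c1 _ o1 fr1 val1.
apply: runs_chain.
(* The row pointer is not reset between scans: each one leaves it at the start of the next row. *)
pose Inv i c' := [/\ frame 12 (reg c) (reg c'), out c' = out c,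
  reg c' Rtmp = base + i /\ reg c' Rrow = base + i * w,
  reg c' Rnin = \sum_(q < i) is_in u q /\
  reg c' Rnout = \sum_(q < i) is_out u q &
  reg c' Rfail = \sum_(q < i) (is_in u q + is_out u q - 1)].
apply: (@runs_weaken _ _ _ _ (Inv w)); first exact: leqnn.
- move=> c2 [fr2 o2 _ [i2 u2] f2].
  apply: (@runs_pure 12) => //= c3 _ o3 fr3 val3.
  have [[g0 g1 g2 g3 g4] _ _ _ _] := @memory_frame 12 u _ _ isT fr2 mem.
  split; [exact: frame_trans fr3 | by rewrite o3 o2 |].
  by rewrite val3 /= i2 u2 f2 g3 g4.
apply: (@runs_count Inv) => //.
- move=> i {o1 fr1 val1}c1 iw [fr1 o1 [t1 r1] [i1 u1] f1] hc.
  have mem1 := @memory_frame 12 u _ _ isT fr1 mem.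
  have [[g0 g1 g2 g3 g4] g5 _ _ _] := mem1.
  apply: runs_chain; apply: (@runs_pure 20) => //= c2 _ o2 fr2 val2.
  apply: runs_chain.
  have S2 := @runs_scan u i c2 iw (@memory_frame 20 _ _ _ isT fr2 mem1).
  apply: (runs_weaken (leqnn _) _ (S2 _ _ _ _)).
  + move=> c3 {S2} [fr3 o3 r3 i3 u3].
    have fr13 : frame 20 (reg c1) (reg c3) by apply: frame_trans fr3.
    have mem3 := @memory_frame 20 u _ _ isT fr13 mem1.
    have [[k0 k1 k2 k3 k4] k5 _ _ _] := mem3.
    apply: (@runs_pure 12) => //= c4 _ o4 fr4 val4.
    split; last by rewrite val4 /= k1 fr13 // hc; lia.
    split; rewrite ?o4 ?o3 ?o2 //.
    * apply: frame_trans fr4 => //.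
      by apply: frame_trans fr13.
    * by rewrite !val4 /= k1 fr13 // t1 r3 mulSn; split; lia.
    * rewrite !val4 /= k1 !sub1_sub1 i3 u3 !val2 /= !add0n !fr13 // i1 u1.
      by rewrite !big_ord_recr.
    * rewrite !val4 /= k1 !sub1_sub1 i3 u3 !val2 /= !add0n !fr13 // f1.
      by rewrite !big_ord_recr.
  + by rewrite val2 /= g3 g0 addn0.
  + by rewrite val2.
  + by rewrite val2 /= t1 g0 addn0.
  + by rewrite val2 /= g5 g0 addn0.
- split; rewrite ?val1 //= ?val1 /= ?big_ord0 //.
- by rewrite val1 /= h3 h0 addn0.
(* The w iterations take 16w + 17 steps each; the 11 instructions outside the loop are absorbed by
   12w^2. *)
simpl. nia.
Qed.

Definition positions u := [seq p <- iota 0 w | nth false u p].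

Lemma digitE u p : digit u p = if p < size u then (nth false u p).+1 else 0.
Proof.
rewrite /digit; case: ltnP => pu; last by rewrite nth_default ?size_map.
by rewrite (nth_map false).
Qed.

Lemma runs_print u c : memory u (reg c) -> size u = w ->
  runs print (12 * w) c (fun c' =>
    [/\ frame 12 (reg c) (reg c'), reg c' Rfail = reg c Rfail,
      reg c' Rtmp = reg c Rtmp & out c' = out c ++ positions u]).
Proof.
move=> mem su; have [[h0 h1 h2 h3 h4] h5 h6 hM hx] := mem.
eapply runs_leq.
apply: runs_chain; apply: (@runs_pure 12) => //= c1 _ o1 fr1 val1.
pose Inv i c' := [/\ frame 12 (reg c) (reg c'),
  reg c' Rfail = reg c Rfail /\ reg c' Rtmp = reg c Rtmp,
  reg c' Rnin = i, reg c' Rdig = base + w * w + i &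
  out c' = out c ++ [seq p <- iota 0 i | nth false u p]].
apply: (@runs_weaken _ _ _ _ (Inv w)); first exact: leqnn.
  by move=> c2 [? [? ?] _ _ ?].
apply: (@runs_count Inv) => //.
- move=> i {o1 fr1 val1}c1 iw [fr1 [f1 t1] i1 d1 o1] hc.
  have mem1 := @memory_frame 12 u _ _ isT fr1 mem.
  have [[g0 g1 g2 g3 g4] g5 _ _ gx] := mem1.
  apply: runs_chain; apply: (@runs_pure 20) => //=.
    by rewrite d1 -addnA leq_addr.
  move=> c2 _ o2 fr2 val2; apply: runs_chain.
  (* The prefix is full, so its digits are 1 or 2, and 2 minus the digit is 0 exactly for the labels
     that are in; only these get written. *)
  have e2 : reg c2 Rdigit = ~~ nth false u i :> nat.
    by rewrite val2 /= d1 g2 gx // digitE su iw; case: nth.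
  pose Q c3 := reg c3 =1 reg c2 /\
    out c3 = out c ++ [seq p <- iota 0 i.+1 | nth false u p].
  have Eio : iota 0 i.+1 = rcons (iota 0 i) i by rewrite -addn1 iotaD cats1.
  apply: (@runs_weaken _ 2 _ _ Q) => //.
  + move=> c3 [r3 o3]; apply: (@runs_pure 12) => //= c4 _ o4 fr4 val4.
    have fr13 : frame 20 (reg c1) (reg c3).
      by move=> a ha; rewrite r3 fr2.
    split; last by rewrite val4 /= !fr13 // hc g1; lia.
    split; rewrite ?o4 //.
    * apply: frame_trans fr4 => //.
      by apply: frame_trans fr13.
    * by rewrite !val4 /= !fr13.
    * by rewrite val4 /= !fr13 // i1 g1 addn1.
    * by rewrite val4 /= r3 val2 /= fr13 // d1 g1 addn1 addnS.
  + apply: runs_unless => [|].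
    * rewrite e2 /Q Eio filter_rcons; case: nth => //= _.
      by rewrite o2.
    * move=> ni; apply: runs_write => c3 _ o3 r3; split=> //.
      rewrite Eio filter_rcons; move: ni; rewrite e2; case: nth => //= _.
      by rewrite o3 o2 fr2 // i1 o1 rcons_cat.
- split; rewrite ?val1 //= ?cats0 // ?h5 ?h0 //.
- by rewrite val1 /= h3 h0 addn0.
simpl; lia.
Qed.

(** The case m = w is included: for a full prefix [down] stores a 0 at [Rend], just beyond the
    digits. *)
Lemma memory_store u u' m X X' :
  memory u X ->
  (forall a, a != base + w * w + m -> X' a = X a) ->
  (m < w -> X' (base + w * w + m) = digit u' m) ->
  (forall p, p < w -> p != m -> digit u' p = digit u p) ->
  memory u' X'.
Proof.
move=> [[h0 h1 h2 h3 h4] h5 h6 hM hx] E hm hd.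
have small a : a < base -> X' a = X a by move=> a32; rewrite E //; lia.
split; first by rewrite !small.
- by rewrite small.
- by rewrite small.
- move=> q p qw pw; rewrite E ?hM //.
  have : q.+1 * w <= w * w by rewrite leq_mul2r qw orbT.
  by rewrite mulSn; lia.
- move=> p pw; have [pm|pm] := eqVneq p m; first by rewrite pm hm // -pm.
  by rewrite E ?hx ?hd // eqn_add2l.
Qed.

Lemma digit_rcons u b p :
  digit (rcons u b) p = if p == size u then (b : nat).+1 else digit u p.
Proof.
rewrite /digit map_rcons nth_rcons size_map.
by case: ltngtP => // up; rewrite nth_default ?size_map // ltnW.
Qed.

Definition feasible u := failure u == 0.
Definition extensible u := feasible u && (size u < w).

Lemma runs_down u c :
  memory u (reg c) -> reg c Rcur = base + w * w + size u -> size u <= w ->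
  runs down (28 * (w * w) + 29 * w + 11) c (fun c' =>
    let e := extensible u in
    [/\ memory (if e then rcons u true else u) (reg c'),
        reg c' Rcur = base + w * w + (size u + e), reg c' Rmode = e,
        reg c' Rold = reg c Rold &
        out c' = out c ++
          if feasible u && (size u == w) then positions u else [::]]).
Proof.
move=> mem hcur uw.
eapply runs_leq.
apply: runs_chain; apply: runs_weaken (leqnn _) _ (runs_check mem).
move=> c1 [fr1 o1 f1].
have mem1 := @memory_frame 12 u _ _ isT fr1 mem.
have [[g0 g1 g2 g3 g4] g5 g6 _ _] := mem1.
apply: runs_chain; apply: (@runs_pure 12) => //= c2 _ o2 fr2 val2.
have {val2} [t2 s2 f2]: [/\ reg c2 Rtmp = w - size u,
    reg c2 Rsum = failure u + (w - size u) & reg c2 Rfail = failure u].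
  by rewrite !val2 /= f1 g6 fr1 // hcur; split; lia.
have {}fr2 : frame 12 (reg c) (reg c2) by apply: frame_trans fr2.
have mem2 := @memory_frame 12 u _ _ isT fr2 mem.
pose Q c3 := [/\ frame 12 (reg c) (reg c3), reg c3 Rfail = failure u,
  reg c3 Rtmp = w - size u & out c3 = out c ++
          if feasible u && (size u == w) then positions u else [::]].
(* [Rsum] is 0 exactly when the prefix is both feasible and full, and only then does [print] run. *)
apply: runs_chain; apply: (@runs_weaken _ (12 * w).+1 _ _ Q) => //; last first.
  apply: runs_unless => [|e2]; rewrite ?s2.
    move=> pos; split; rewrite ?o2 ?o1 //.
    case: eqP => [su|]; rewrite ?andbF ?cats0 // andbT /feasible.
    by rewrite su subnn addn0 in pos; rewrite eqn0Ngt pos cats0.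
  have [fz su] : failure u = 0 /\ size u = w by rewrite s2 in e2; lia.
  apply: runs_weaken (leqnn _) _ (runs_print mem2 su) => c3 [fr3 f3 t3 o3].
  split; [exact: frame_trans fr3 | by rewrite f3 | by rewrite t3 |].
  by rewrite o3 o2 o1 /feasible fz su !eqxx.
move=> c3 [fr3 f3 t3 o3].
have mem3 := @memory_frame 12 u _ _ isT fr3 mem.
have [[k0 k1 k2 k3 k4] k5 k6 _ kx] := mem3.
apply: runs_chain; apply: (@runs_pure 12) => //= c4 _ o4 fr4 val4.
(* The truth value of size u < w, minus the failure count, truncated at 0. *)
have t4 : reg c4 Rtmp = extensible u.
  rewrite val4 /= k1 f3 t3 sub1_sub1 /extensible /feasible subn_gt0.
  by case: (failure u) => [|m]; case: ltnP.
have s4 : reg c4 Rsum = extensible u + extensible u.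
  by rewrite -[in RHS]t4 !val4 /=.
have {}fr4 : frame 12 (reg c) (reg c4) by apply: frame_trans fr4.
have mem4 := @memory_frame 12 u _ _ isT fr4 mem.
apply: runs_chain; apply: runs_store => c5 _ o5.
rewrite s4 fr4 // hcur => v5 E5.
set e := extensible u in s4 v5 *.
have sv : reg c5 Rcur = base + w * w + size u by rewrite E5 ?fr4 //; lia.
have tv : reg c5 Rtmp = e by rewrite E5 //; lia.
have mem5 : memory (if e then rcons u true else u) (reg c5).
  apply: memory_store mem4 E5 _ _.
  - move=> su; rewrite v5 /e; case: ifP => _; first by rewrite digit_rcons eqxx.
    by rewrite digitE ltnn.
  - by move=> p pw pu; rewrite /e; case: ifP => // _; rewrite digit_rcons ifN.
apply: (@runs_pure 7) => //= c6 _ o6 fr6 val6.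
have [[l0 _ _ _ _] _ _ _ _] := mem5.
split.
- by apply: memory_frame mem5; last exact: fr6.
- by rewrite val6 /= sv tv addnA.
- by rewrite val6 /= tv l0 addn0.
- by rewrite val6 /= E5 ?fr4 //; lia.
- by rewrite o6 o5 o4 o3.
simpl; lia.
Qed.

(** The old last digit minus 1 is [b]. It serves as the new digit, as the increment of [Rcur] and as
    the new mode: after a 2 the sibling has to be explored, after a 1 the subtree of [u] is
    finished. *)
Lemma runs_up u b c :
  memory (rcons u b) (reg c) -> reg c Rcur = base + w * w + (size u).+1 ->
  size u < w ->
  runs up 5 c (fun c' =>
    [/\ memory (if b then rcons u false else u) (reg c'),
        reg c' Rcur = base + w * w + (size u + b), reg c' Rmode = b &
        out c' = out c]).
Proof.
move=> mem hcur uw.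
have [[h0 h1 h2 h3 h4] h5 h6 _ hx] := mem.
eapply runs_leq.
apply: runs_chain; apply: (@runs_pure 7) => //=.
  by rewrite hcur h1; lia.
move=> c1 _ o1 fr1 val1.
have E : reg c Rcur - reg c Rone = base + w * w + size u.
  by rewrite hcur h1; lia.
have m1 : reg c1 Rmode = b.
  by rewrite val1 /= E hx // digit_rcons eqxx h1; lia.
have c1c : reg c1 Rcur = base + w * w + size u by rewrite val1 /= E.
have mem1 := @memory_frame 7 (rcons u b) _ _ isT fr1 mem.
apply: runs_chain; apply: runs_store => c2 _ o2.
rewrite m1 c1c => v2 E2.
have mem2 : memory (if b then rcons u false else u) (reg c2).
  apply: memory_store mem1 E2 _ _.
  - move=> _; rewrite v2.
    by case: b {mem hx m1 v2}; rewrite ?digit_rcons ?eqxx // digitE ltnn.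
  - by move=> p pw pu; case: b {mem hx m1 v2}; rewrite !digit_rcons ifN ?ifN.
apply: (@runs_pure 7) => //= c3 _ o3 fr3 val3; split.
- by apply: memory_frame mem2; last exact: fr3.
- by rewrite val3 /= !E2 ?c1c ?m1 ?addnA //; lia.
- by rewrite val3 /= E2 //; lia.
- by rewrite o3 o2 o1.
by [].
Qed.

(** * The search loop and the backtracking tree *)

(** [Ractive] is 0 only for the empty prefix with its subtree finished, which is when the search
    ends. *)
Definition search_state (b : bool) u o c : Prop :=
  [/\ memory u (reg c), reg c Rcur = base + w * w + size u,
      reg c Rmode = b, reg c Ractive = size u + b & out c = o].

Lemma runs_search_body_down u o c :
  search_state true u o c -> size u <= w ->
  runs search_body (28 * (w * w) + 29 * w + 17) c
    (search_state (extensible u) (if extensible u then rcons u true else u)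
       (o ++ if feasible u && (size u == w) then positions u else [::])).
Proof.
move=> [mem hcur hmode _ ho] uw.
have [[h0 h1 _ _ _] _ _ _ _] := mem.
eapply runs_leq.
apply: runs_chain; apply: (@runs_pure 9) => //= c1 _ o1 fr1 val1.
have mem1 := @memory_frame 9 u _ _ isT fr1 mem.
have hcur1 : reg c1 Rcur = base + w * w + size u by rewrite fr1.
have flag1 : reg c1 Rflag = 0 by rewrite val1 /= h1 hmode.
have old1 : reg c1 Rold = 1 by rewrite val1 /= h0 hmode.
apply: runs_chain; apply: runs_unless => [|_]; first by rewrite flag1.
apply: runs_weaken (leqnn _) _ (runs_down mem1 hcur1 uw).
move=> c2 [mem2 hcur2 hmode2 old2 o2].
apply: runs_chain.
(* The mode saved in [Rold] is 1, so [up] is skipped even if [down] has just set [Rmode] to 0. *)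
apply: (@runs_unless _ _ 0) => [_|]; last by rewrite old2 old1.
apply: (@runs_pure 9) => //= c3 _ o3 fr3 val3.
have [_ h5 _ _ _] := mem2.
split.
- by apply: memory_frame mem2; last exact: fr3.
- rewrite fr3 // hcur2; case: ifP => _; rewrite ?size_rcons; lia.
- by rewrite fr3.
- by rewrite val3 /= hcur2 h5 hmode2; case: ifP => _; rewrite ?size_rcons; lia.
- by rewrite o3 o2 o1 ho.
simpl; lia.
Qed.

Lemma runs_search_body_up u b o c :
  search_state false (rcons u b) o c -> size u < w ->
  runs search_body 12 c
    (search_state b (if b then rcons u false else u) o).
Proof.
move=> [mem hcur hmode _ ho] uw.
have [[h0 h1 _ _ _] _ _ _ _] := mem.
eapply runs_leq.
apply: runs_chain; apply: (@runs_pure 9) => //= c1 _ o1 fr1 val1.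
have mem1 := @memory_frame 9 _ _ _ isT fr1 mem.
have hcur1 : reg c1 Rcur = base + w * w + (size u).+1.
  by rewrite fr1 // hcur size_rcons.
have flag1 : reg c1 Rflag = 1 by rewrite val1 /= h1 hmode.
have old1 : reg c1 Rold = 0 by rewrite val1 /= h0 hmode.
apply: runs_chain; apply: (@runs_unless _ _ 0) => [_|]; last by rewrite flag1.
apply: runs_chain; apply: runs_unless => [|_]; first by rewrite old1.
apply: runs_weaken (leqnn _) _ (runs_up mem1 hcur1 uw).
move=> c2 [mem2 hcur2 hmode2 o2].
apply: (@runs_pure 9) => //= c3 _ o3 fr3 val3.
have [_ h5 _ _ _] := mem2.
split.
- by apply: memory_frame mem2; last exact: fr3.
- rewrite fr3 // hcur2; case: ifP => _; rewrite ?size_rcons; lia.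
- by rewrite fr3.
- by rewrite val3 /= hcur2 h5 hmode2; case: ifP => _; rewrite ?size_rcons; lia.
- by rewrite o3 o2 o1 ho.
by [].
Qed.

(** Here n is the number of undecided labels. The leaves come in the order of the machine: first in,
    then out. *)
Fixpoint leaves n u : seq (seq bool) :=
  if feasible u then
    if n is m.+1 then leaves m (rcons u true) ++ leaves m (rcons u false)
    else [:: u]
  else [::].

(** Infeasible children are counted too, since the machine visits them before it rejects them. *)
Fixpoint nodes n u : nat :=
  if n is m.+1 then
    if feasible u then (nodes m (rcons u true) + nodes m (rcons u false)).+1
    else 1
  else 1.

(** The part of the search that follows the subtree of [u] is a hypothesis, with its own budget T;
    so the induction hypotheses for the two children can be composed. *)
Lemma runs_search_from n u o c T (Q : config -> Prop) :
  size u + n = w -> search_state true u o c ->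
  (forall c', search_state false u
      (o ++ flatten [seq positions v | v <- leaves n u]) c' ->
     if 0 < reg c' Ractive then runs search T c' Q else Q c') ->
  runs search (120 * (w * w) * nodes n u + T) c Q.
Proof.
(* A node pays for its downward iteration and, if it has children, for the two upward iterations, of
   12 + 1 steps each, that leave them. *)
have le_node : 28 * (w * w) + 29 * w + 18 <= 120 * (w * w) - 26.
  by move: w_gt0; clear; case: w => // m _; nia.
have w2 : 26 <= 120 * (w * w) by move: w_gt0; clear; case: w => // m _; nia.
elim: n u o c T => [|n IH] u o c T uw st H.
  have su : size u = w by lia.
  rewrite muln1.
  apply: (@runs_leq _ ((28 * (w * w) + 29 * w + 17).+1 + T)); last by lia.
  apply: runs_repeat.
  apply: runs_weaken (leqnn _) _ (runs_search_body_down st _); last by lia.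
  rewrite /extensible su ltnn eqxx andbT andbF => c' /= st'; apply: H.
  by move: st' => /=; case: ifP => _ /=; rewrite ?cats0.
have su : size u < w by lia.
rewrite /=; case fu: (feasible u); last first.
  rewrite muln1.
  apply: (@runs_leq _ ((28 * (w * w) + 29 * w + 17).+1 + T)); last by lia.
  apply: runs_repeat.
  apply: runs_weaken (leqnn _) _ (runs_search_body_down st _); last by lia.
  by rewrite /extensible fu /= => c' /= st'; apply: H; rewrite /= fu.
set N1 := nodes _ _; set N0 := nodes _ _.
apply: (@runs_leq _ ((28 * (w * w) + 29 * w + 17).+1 +
   (120 * (w * w) * N1 + (13 + (120 * (w * w) * N0 + (13 + T)))))); last first.
  by rewrite mulnS mulnDr; lia.
apply: runs_repeat.
apply: runs_weaken (leqnn _) _ (runs_search_body_down st _); last by lia.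
rewrite /extensible fu su (ltn_eqF su) /= cats0 => c1 st1.
have -> : 0 < reg c1 Ractive by case: st1 => _ _ _ ->; rewrite addn1.
apply: (IH _ _ _ _ _ st1) => [|c2 st2]; first by rewrite size_rcons; lia.
have -> : 0 < reg c2 Ractive by case: st2 => _ _ _ ->; rewrite size_rcons.
(* From the finished first child to its sibling. *)
apply: (@runs_repeat _ _ 12).
apply: runs_weaken (leqnn _) _ (runs_search_body_up st2 su) => c3 /= st3.
have -> : 0 < reg c3 Ractive by case: st3 => _ _ _ ->; rewrite addn1.
apply: (IH _ _ _ _ _ st3) => [|c4 st4]; first by rewrite size_rcons; lia.
have -> : 0 < reg c4 Ractive by case: st4 => _ _ _ ->; rewrite size_rcons.
(* From the finished second child back to [u], now finished as well. *)
apply: (@runs_repeat _ _ 12).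
apply: runs_weaken (leqnn _) _ (runs_search_body_up st4 su) => c5 /= st5.
by apply: H; rewrite /= fu map_cat flatten_cat catA.
Qed.

End Machine.

(** * Reading the input *)

Section ReadInput.

Variables (w k : nat) (s : seq nat).
Hypothesis w_gt0 : 0 < w.

Lemma runs_read_row i c :
  i < w -> reg c Rone = 1 -> reg c Rcount2 = w -> reg c Rbeg = base + i * w ->
  runs (repeat read_row_body Rcount2) (5 * w) c (fun c' =>
    [/\ inp c' = drop w (inp c), out c' = out c, reg c' Rbeg = base + i * w + w,
        forall a, a < 16 -> a != Rbeg -> reg c' a = reg c a &
        forall a, base <= a -> reg c' a =
          if base + i * w <= a < base + i * w + w
          then nth 0 (inp c) (a - (base + i * w)) else reg c a]).
Proof.
move=> iw h1 hc hb.
pose Inv j c' := [/\ inp c' = drop j (inp c), out c' = out c,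
  reg c' Rbeg = base + i * w + j,
  forall a, a < 16 -> a != Rbeg -> reg c' a = reg c a &
  forall a, base <= a -> reg c' a =
    if base + i * w <= a < base + i * w + j
    then nth 0 (inp c) (a - (base + i * w)) else reg c a].
apply: (@runs_count Inv) => //; last first.
  split; rewrite ?drop0 ?addn0 // => a _.
  by rewrite ifF //; lia.
move=> j {}c1 jw [i1 o1 b1 f1 m1] c1j.
eapply runs_leq.
apply: runs_chain; apply: runs_read => c2 i2 o2 r2.
apply: runs_chain; apply: runs_store.
rewrite (r2 Rbeg) (r2 Rtmp) /= b1 => c3 i3 o3 v3 r3.
have q3 a : a < base -> a != Rtmp -> reg c3 a = reg c1 a.
  by move=> a32 a16; rewrite r3 ?r2 ?ifN //; lia.
apply: (@runs_pure 5) => //= c4 i4 o4 fr4 val4.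
split; last by rewrite val4 /= !q3 // c1j f1 // h1; lia.
split.
- by rewrite i4 i3 i2 i1 -drop1 drop_drop add1n.
- by rewrite o4 o3 o2.
- by rewrite val4 /= !q3 // b1 f1 // h1; lia.
- move=> a a16 a5; rewrite val4 /= (negPf a5) ifN ?q3 ?f1 //; lia.
- move=> a a32; rewrite fr4 ?a32 ?orbT //.
  have [->|na] := eqVneq a (base + i * w + j).
    by rewrite v3 i1 -nth0 nth_drop addn0 ifT; [congr nth; lia | lia].
  have -> : reg c3 a = reg c1 a by rewrite r3 ?r2 ?ifN //; lia.
  rewrite m1 //; case: ifP => h; case: ifP => h' //; lia.
by [].
Qed.

(** [Rbeg] is the write pointer while the matrix is read, and ends where the digits begin. *)
Lemma runs_read_input c :
  reg c =1 (fun=> 0) -> inp c = [:: w, k & s] ->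
  runs read_input (40 * (w * w)) c
    (search_state w k (fun q p => nth 0 s (q * w + p)) true [::] (out c)).
Proof.
move=> h0 hi; eapply runs_leq.
apply: runs_chain; apply: runs_read => c1 i1 o1 r1.
apply: runs_chain; apply: runs_read => c2 i2 o2 r2.
apply: runs_chain; apply: (@runs_pure 1) => //= c3 i3 o3 fr3 val3.
have {}i3 : inp c3 = s by rewrite i3 i2 i1 hi.
pose Inv i c' := [/\ inp c' = drop (i * w) s /\ out c' = out c,
   [/\ reg c' Rzero = 0, reg c' Rone = 1, reg c' Rtwo = 2, reg c' Rw = w &
       reg c' Rk = k],
   reg c' Rbeg = base + i * w &
   forall a, base <= a -> reg c' a =
     if a < base + i * w then nth 0 s (a - base) else 0].
apply: runs_chain; apply: (@runs_weaken _ _ _ _ (Inv w)); first exact: leqnn.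
  move=> c4 [[i4 o4] [g0 g1 g2 g3 g4] b4 m4].
  apply: (@runs_pure 6) => //= c5 _ o5 fr5 val5.
  split; rewrite ?o5 ?o4 ?val5 //= ?b4 ?g0 ?addn0 //.
  split; rewrite ?val5 //= ?b4 ?g3 //.
  - move=> q p qw pw; have : q.+1 * w <= w * w by rewrite leq_mul2r qw orbT.
    rewrite mulSn -addnA => le; have a32 := leq_addr (q * w + p) base.
    by rewrite fr5 ?a32 ?orbT // m4 // ifT ?addKn //; lia.
  (* The digit cells still hold their initial 0, so the prefix is empty. *)
  - move=> p pw; rewrite -addnA; have a32 := leq_addr (w * w + p) base.
    by rewrite fr5 ?a32 ?orbT // m4 // ifF ?digitE //; lia.
apply: (@runs_count Inv) => //.
- move=> i {val3 fr3 o3 i3}c3 iw [[i3 o3] [g0 g1 g2 g3 g4] b3 m3] hc.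
  apply: runs_chain; apply: (@runs_pure 16) => //= c4 i4 o4 fr4 val4.
  apply: runs_chain.
  have R4 := @runs_read_row i c4 iw.
  apply: (runs_weaken (leqnn _) _ (R4 _ _ _)).
  + move=> c5 [i5 o5 b5 f5 m5].
    have q5 a : a < 16 -> a != Rbeg -> reg c5 a = reg c3 a.
      by move=> a16 a5; rewrite f5 ?fr4 ?a16.
    apply: (@runs_pure 12) => //= c6 i6 o6 fr6 val6.
    split; last by rewrite val6 /= !q5 // hc g1; lia.
    split.
    * by rewrite i6 o6 i5 o5 i4 o4 i3 drop_drop mulSn.
    * by rewrite !fr6 ?q5.
    * by rewrite fr6 // b5 mulSn; lia.
    * move=> a a32; rewrite fr6 ?a32 ?orbT // m5 // fr4 ?a32 ?orbT // m3 //.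
      rewrite i4 i3 nth_drop mulSn.
      case: ifP => h; case: ifP => h'; try lia.
      -- by congr nth; lia.
      -- by rewrite ifT //; lia.
      -- by rewrite ifF //; lia.
  + by rewrite fr4.
  + by rewrite val4 /= g3 g0 addn0.
  + by rewrite fr4.
- split; rewrite ?mul0n ?addn0 ?drop0 //.
  + by rewrite o3 o2 o1.
  + by rewrite !val3 /= !r2 /= !r1 /= !h0 i1 hi.
  + move=> a a32; rewrite fr3 ?a32 ?orbT // r2 r1 h0.
    by rewrite !ifF //; lia.
- by rewrite val3 /= !r2 /= !r1 /= hi h0 addn0.
simpl; move: w_gt0; clear; case: w => // m _; nia.
Qed.

Lemma ideal_lister_outputs :
  let M := fun q p => nth 0 s (q * w + p) in
  outputs_within (ideal_lister 0) [:: w, k & s]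
    (160 * (w * w) * nodes w k M w [::])
    (flatten [seq positions w v | v <- leaves w k M w [::]]).
Proof.
move=> M; apply: runs_outputs; eapply runs_leq.
apply: runs_chain.
apply: runs_weaken (leqnn _) _ _; last exact: runs_read_input.
  move=> c st; apply: (runs_search_from w_gt0 _ st (T := 0)) => // c'.
  by case=> _ _ _ -> ->.
rewrite addn0 -/M -!(mulnA _ (w * w)).
(* There is at least one node, so the 40w^2 steps of the input phase raise the cost per node from
   120w^2 to 160w^2. *)
have : w * w <= w * w * nodes w k M w [::].
  by rewrite leq_pmulr //; case: (w) => //= m; case: ifP.
lia.
Qed.

End ReadInput.

(** * Order ideals and the extension criterion for prefixes *)

Section OrderIdeals.

Import Order.POrderTheory.

Variables (d : Order.disp_t) (W : finPOrderType d).
Implicit Types X Y : {set W}.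

Lemma order_idealP X :
  reflect (forall p q, p \in X -> (q <= p)%O -> q \in X) (order_ideal X).
Proof.
apply: (iffP forall_inP) => [H p q pX qp | H p pX].
  by move/forallP: (H p pX) => /(_ q); rewrite qp.
by apply/forallP => q; apply/implyP; apply: H.
Qed.

(** Induction on k - |X|: adjoining to X a minimal element of Y \ X gives an order ideal that still
    lies in Y. *)
Lemma order_ideal_between X Y k :
  order_ideal X -> order_ideal Y -> X \subset Y -> #|X| <= k <= #|Y| ->
  exists2 Z, Z \in ideals_of_card W k & X \subset Z /\ Z \subset Y.
Proof.
move=> idX /order_idealP idY XY /andP[Xk kY].
move En : (k - #|X|) => n; elim: n X idX XY Xk En => [|n IH] X idX XY Xk En.
  by exists X; rewrite // inE idX eqn_leq Xk -subn_eq0 En.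
have /order_idealP idX' := idX.
have : 0 < #|Y :\: X| by rewrite cardsDS // subn_gt0; lia.
case/card_gt0P=> x0 x0P.
(* The size of a principal ideal is strictly increasing in its generator, so a minimizer of [height]
   on Y \ X is a minimal element there. *)
pose height (y : W) := #|[set z | (z <= y)%O]|.
case: (@arg_minnP _ x0 (mem (Y :\: X)) height) => // x /setDP[xY xX] xmin.
have lower z : (z < x)%O -> z \in X.
  move=> zx; apply: contraLR (zx) => zX; apply/negP => _.
  have /xmin : z \in Y :\: X by rewrite inE zX (idY _ _ xY (ltW zx)).
  rewrite leqNgt => /negP; apply; apply: proper_card; apply/properP; split.
    apply/subsetP=> t; rewrite !inE => tz.
    by apply: le_trans tz _; apply: ltW.
  exists x; rewrite !inE ?lexx //.
  by rewrite lt_geF.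
have [||||Z Zk [XZ ZY]] := IH (x |: X).
- apply/order_idealP => p q; rewrite !inE => /orP[/eqP->|pX].
    by rewrite le_eqVlt => /orP[-> // | /lower ->]; rewrite orbT.
  move=> qp.
  by rewrite (idX' p q) ?orbT.
- by rewrite subUset sub1set xY.
- by rewrite cardsU1 xX; lia.
- by rewrite cardsU1 xX; lia.
by exists Z => //; split=> //; apply: subset_trans XZ; apply: subsetUr.
Qed.

Variables (w k : nat) (lab : 'I_w -> W) (M : nat -> nat -> nat).
Hypotheses (lab_bij : bijective lab)
  (ME : forall i j : 'I_w, M i j = (lab i <= lab j)%O).
Implicit Types u v : seq bool.

Definition bits X : seq bool := [seq lab i \in X | i <- enum 'I_w].

Definition lower_closure u : {set W} := [set x |
  [exists p : 'I_w, (p < size u) && nth false u p && (x <= lab p)%O]].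
Definition upper_closure u : {set W} := [set x |
  [exists p : 'I_w, (p < size u) && ~~ nth false u p && (lab p <= x)%O]].

Lemma size_bits X : size (bits X) = w.
Proof. by rewrite size_map size_enum_ord. Qed.

Lemma nth_bits X (i : 'I_w) : nth false (bits X) i = (lab i \in X).
Proof. by rewrite (nth_map i) ?size_enum_ord // nth_ord_enum. Qed.

Lemma bits_inj : injective bits.
Proof.
move=> X Y E; have [g _ gK] := lab_bij.
by apply/setP=> x; rewrite -(gK x) -!nth_bits E.
Qed.

Lemma prefix_bitsP u X : size u <= w ->
  reflect (forall i : 'I_w, i < size u -> nth false u i = (lab i \in X))
    (prefix u (bits X)).
Proof.
move=> uw; rewrite prefixE; apply: (iffP eqP) => [E i iu | H].
  by rewrite -[in LHS]E nth_take // nth_bits.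
apply: (@eq_from_nth _ false) => [|i]; first by rewrite size_takel ?size_bits.
rewrite size_takel ?size_bits // => iu.
by rewrite nth_take // (H (Ordinal (leq_trans iu uw))) // -nth_bits.
Qed.

Lemma is_inE u (q : 'I_w) : is_in w M u q = (lab q \in lower_closure u).
Proof.
rewrite /is_in inE lt0n sum_nat_eq0 negb_forall; apply: eq_existsb => p /=.
rewrite /below ME digitE; case: ltnP => _; last by case: (_ <= _)%O.
by case: nth; case: (_ <= _)%O.
Qed.

Lemma is_outE u (q : 'I_w) : is_out w M u q = (lab q \in upper_closure u).
Proof.
rewrite /is_out inE lt0n sum_nat_eq0 negb_forall; apply: eq_existsb => p /=.
rewrite /above ME digitE; case: ltnP => _; last by case: (_ <= _)%O.
by case: nth; case: (_ <= _)%O.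
Qed.

Lemma sum_mem_lab X : \sum_(q < w) (lab q \in X) = #|X|.
Proof.
rewrite -sum1_card [RHS]big_mkcond /= (reindex lab) /=.
  by apply: eq_bigr => i _; case: (_ \in _).
by have [g gK Kg] := lab_bij; exists g => x _; rewrite ?gK ?Kg.
Qed.

Lemma card_lab : #|W| = w.
Proof. by rewrite -(bij_eq_card lab_bij) card_ord. Qed.

Lemma failureE u : failure w k M u =
  #|lower_closure u :&: upper_closure u| +
  (#|lower_closure u| - k) + (#|upper_closure u| + k - w).
Proof.
congr (_ + (_ - k) + (_ + k - w)); rewrite -sum_mem_lab; apply: eq_bigr => q _.
- by rewrite is_inE is_outE in_setI; do 2!case: (_ \in _).
- by rewrite is_inE.
- by rewrite is_outE.
Qed.

Lemma feasibleP u : size u <= w ->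
  reflect (exists2 X, X \in ideals_of_card W k & prefix u (bits X))
    (feasible w k M u).
Proof.
move=> uw; rewrite /feasible failureE !addn_eq0 cards_eq0 -andbA.
apply: (iffP and3P) => [[/eqP LU0 Lk Uk] | [X]]; last first.
  move=> /[!inE] /andP[/order_idealP idX /eqP cX].
  move=> /(prefix_bitsP _ uw) uX.
  (* Necessity: an order ideal that agrees with [u] contains I, and its complement, an up-set,
     contains O. *)
  have LX : lower_closure u \subset X.
    apply/subsetP=> x; rewrite inE => /existsP[i /andP[/andP[iu ui] xi]].
    by apply: idX xi; rewrite -uX.
  have UX : upper_closure u \subset ~: X.
    apply/subsetP=> x; rewrite !inE => /existsP[i /andP[/andP[iu ui] xi]].
    by apply: contra ui => xX; rewrite uX // (idX _ _ xX).
  split.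
  - by rewrite setI_eq0 disjoints_subset (subset_trans LX) // -setCS setCK.
  - by rewrite subn_eq0 -cX subset_leq_card.
  - have := subset_leq_card UX; have := cardsC X; rewrite card_lab cX.
    by move=> *; rewrite subn_eq0; lia.
(* Sufficiency: I and the complement of O are order ideals, nested because I n O = 0, and their
   sizes enclose k. *)
have [||||X Xk [LX XU]] :=
  @order_ideal_between (lower_closure u) (~: upper_closure u) k.
- apply/order_idealP => p q; rewrite !inE => /existsP[i /andP[ui pi]] qp.
  by apply/existsP; exists i; rewrite ui (le_trans qp pi).
- apply/order_idealP => p q; rewrite !inE => /existsPn H qp.
  apply/existsPn => i; apply: contra (H i) => /andP[-> iq].
  exact: le_trans iq qp.
- by rewrite -disjoints_subset -setI_eq0 LU0.
- by have := cardsC (upper_closure u); rewrite card_lab; lia.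
exists X => //; apply/prefix_bitsP => // i iu; case ui: (nth false u i).
  apply/esym/(subsetP LX); rewrite inE; apply/existsP; exists i.
  by rewrite iu ui lexx.
apply/esym/negP => /(subsetP XU); rewrite !inE => /existsPn/(_ i).
by rewrite iu ui lexx.
Qed.

(** * The leaves of the search tree: completeness, counting and listing *)

Lemma prefix_rcons_bool u v : size u < size v ->
  prefix (rcons u true) v || prefix (rcons u false) v = prefix u v.
Proof.
elim: u v => [|a u IH] [|b v] //=; first by case: b; rewrite !prefix0s.
by rewrite ltnS => /IH <-; case: (a == b).
Qed.

Lemma feasible_prefix u v : size v <= w -> prefix u v ->
  feasible w k M v -> feasible w k M u.
Proof.
move=> vw uv /(feasibleP vw)[X Xk vX].
apply/feasibleP; first exact: leq_trans (size_prefix uv) vw.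
by exists X => //; apply: prefix_trans vX.
Qed.

(** Pruning loses no leaf, because feasibility passes to prefixes. *)
Lemma mem_leaves n u v : size u + n = w ->
  (v \in leaves w k M n u) =
  [&& size v == w, prefix u v & feasible w k M v].
Proof.
elim: n u => [|n IH] u uw /=.
  rewrite addn0 in uw; have [-> | nvu] := eqVneq v u.
    by rewrite uw eqxx prefix_refl /=; case: ifP; rewrite ?inE ?eqxx.
  transitivity false; first by case: ifP; rewrite ?inE ?(negPf nvu).
  apply/esym/and3P => -[/eqP vw uv _]; case/eqP: nvu.
  by move: uv; rewrite prefixE uw -vw take_size => /eqP.
have IHb b : (v \in leaves w k M n (rcons u b)) =
    [&& size v == w, prefix (rcons u b) v & feasible w k M v].
  by rewrite IH // size_rcons -uw addSnnS.
case: ifP => fu.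
  rewrite mem_cat !IHb -andb_orr -andb_orl.
  by case: eqP => //= sv; rewrite prefix_rcons_bool // sv -uw; lia.
apply/esym/and3P => -[/eqP vw uv fv].
by rewrite (feasible_prefix _ uv fv) ?vw in fu.
Qed.

Lemma uniq_leaves n u : size u + n = w -> uniq (leaves w k M n u).
Proof.
elim: n u => [|n IH] u uw /=; first by case: ifP.
have sz b : size (rcons u b) + n = w by rewrite size_rcons -uw addSnnS.
case: ifP => // _; rewrite cat_uniq !IH ?sz // andbT /=.
apply/hasPn => v; rewrite mem_leaves // => /and3P[_ pf _].
rewrite mem_leaves //; apply/and3P => -[_ pt _].
move: pf pt; rewrite !prefixE !size_rcons => /eqP-> /eqP/rcons_inj[].
by [].
Qed.

(** The search has no dead ends below a feasible node; hence its cost can be charged to the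
    output. *)
Lemma leaves_gt0 n u : size u + n = w -> feasible w k M u ->
  0 < size (leaves w k M n u).
Proof.
move=> uw fu; have [|X Xk uX] := feasibleP _ fu; first by rewrite -uw leq_addr.
suff : bits X \in leaves w k M n u by case: leaves.
rewrite mem_leaves // size_bits eqxx uX; apply/feasibleP; rewrite ?size_bits //.
by exists X; rewrite ?prefix_refl.
Qed.

(** A path from [u] down to a leaf has n + 1 nodes, and at most n infeasible siblings hang off
    it. *)
Lemma nodes_leq n u : size u + n = w -> feasible w k M u ->
  nodes w k M n u <= n.*2.+1 * size (leaves w k M n u).
Proof.
elim: n u => [|n IH] u uw fu; first by rewrite /= fu.
have sz b : size (rcons u b) + n = w by rewrite size_rcons -uw addSnnS.
have := leaves_gt0 uw fu; rewrite /= fu size_cat.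
have leaf0 b : ~~ feasible w k M (rcons u b) ->
    leaves w k M n (rcons u b) = [::] /\ nodes w k M n (rcons u b) = 1.
  by case: (n) => [|m] /= /negPf->.
(* One more level adds the node itself and at most one infeasible child; the factor grows by 2 and
   there is a leaf to pay for both. Two infeasible children would leave no leaf. *)
case: (boolP (feasible w k M (rcons u true))) => f1;
  case: (boolP (feasible w k M (rcons u false))) => f0.
- have := IH _ (sz true) f1; have := IH _ (sz false) f0; lia.
- have [-> ->] := leaf0 _ f0; have := IH _ (sz true) f1; rewrite /=; lia.
- have [-> ->] := leaf0 _ f1; have := IH _ (sz false) f0; rewrite /=; lia.
- have [-> _] := leaf0 _ f0; have [-> _] := leaf0 _ f1; rewrite /=; lia.
Qed.

Definition set_of_bits v : {set W} :=
  [set x | [exists i : 'I_w, nth false v i && (x == lab i)]].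

Lemma set_of_bitsK v : size v = w -> bits (set_of_bits v) = v.
Proof.
move=> sv; apply: (@eq_from_nth _ false) => [|i]; rewrite size_bits // => iw.
rewrite (nth_bits _ (Ordinal iw)) inE.
apply/existsP/idP => [[j /andP[vj /eqP/(bij_inj lab_bij) E]]|vi].
  by rewrite [i]/(val (Ordinal iw)) E.
by exists (Ordinal iw); rewrite vi eqxx.
Qed.

Lemma positions_set_of_bits v : size v = w ->
  positions w v = encode_set lab (set_of_bits v).
Proof.
move=> sv; rewrite /positions /encode_set -val_enum_ord filter_map.
by congr map; apply: eq_filter => i /=; rewrite -nth_bits set_of_bitsK.
Qed.

Lemma listing_leaves :
  let s := [seq set_of_bits v | v <- leaves w k M w [::]] in
  listing_of s (ideals_of_card W k).
Proof.
have w0 : size (@nil bool) + w = w by [].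
have sz v : v \in leaves w k M w [::] -> size v = w.
  by rewrite mem_leaves // => /and3P[/eqP].
split.
  rewrite map_inj_in_uniq ?uniq_leaves // => u v /sz su /sz sv E.
  by rewrite -(set_of_bitsK su) E set_of_bitsK.
have memb X : (bits X \in leaves w k M w [::]) = (X \in ideals_of_card W k).
  rewrite mem_leaves // size_bits eqxx prefix0s /=.
  apply/feasibleP/idP => [|[Y Yk]|Xk]; first by rewrite size_bits.
    by rewrite prefixE size_bits -(size_bits Y) take_size => /eqP/bits_inj<-.
  by exists X; rewrite ?prefix_refl.
move=> X; rewrite -memb; apply/mapP/idP => [[v vl ->]|Xl].
  by rewrite set_of_bitsK ?sz.
by exists (bits X) => //; apply: bits_inj; rewrite set_of_bitsK ?size_bits.
Qed.

End OrderIdeals.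

(** * Row-major encoding of the matrix and the final bound *)

Lemma nth_allpairs (S T R : Type) (f : S -> T -> R) x0 y0 z0 s t i j :
  i < size s -> j < size t ->
  nth z0 [seq f x y | x <- s, y <- t] (i * size t + j) =
  f (nth x0 s i) (nth y0 t j).
Proof.
move=> + jt; elim: s i => //= x s IH [|i] is_; rewrite nth_cat size_map.
  by rewrite jt (nth_map y0).
by rewrite mulSn -addnA ltnNge leq_addr addKn IH.
Qed.

Theorem corollary3 :
  exists (A : program) (C : nat),
    forall (d : Order.disp_t) (W : finPOrderType d) (w : nat)
      (lab : 'I_w -> W) (k : nat),
      bijective lab -> 1 <= k <= w ->
      exists2 s : seq {set W},
        listing_of s (ideals_of_card W k) &
        outputs_within A (encode_input lab k)
          (C * (#|ideals_of_card W k| * w ^ 3)) (encode_listing lab s).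
Proof.
(* 480 = 160 * 3: at most 160w^2 steps per node, and at most 2w + 1 <= 3w nodes per leaf. *)
exists (ideal_lister 0), 480 => d W w lab k lab_bij /andP[k_gt0 kw].
pose s := [seq nat_of_bool (lab i <= lab j)%O | i <- enum 'I_w, j <- enum 'I_w].
pose M q p := nth 0 s (q * w + p).
have ME (i j : 'I_w) : M i j = (lab i <= lab j)%O.
  rewrite /M -{2}(size_enum_ord w) (@nth_allpairs _ _ _ _ i j);
    by rewrite ?size_enum_ord // !nth_ord_enum.
have w0 : size (@nil bool) + w = w by [].
set lv := leaves w k M w [::].
have L := listing_leaves k lab_bij ME.
exists [seq set_of_bits lab v | v <- lv] => //.
have N_lv : #|ideals_of_card W k| = size lv.
  by case: L => uL eL; rewrite -(eq_card eL) (card_uniqP uL) size_map.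
(* Since k <= w, some order ideal of size k lies between the empty set and W. So N > 0, and the root
   satisfies the hypothesis of [nodes_leq]. *)
have feas : feasible w k M [::].
  apply/(feasibleP k lab_bij ME) => //.
  have [||||X Xk _] := @order_ideal_between _ W set0 setT k.
  - by apply/order_idealP => p q; rewrite inE.
  - by apply/order_idealP => p q; rewrite !inE.
  - exact: sub0set.
  - by rewrite cards0 cardsT (card_lab lab_bij).
  by exists X; rewrite ?prefix0s.
have -> : encode_listing lab [seq set_of_bits lab v | v <- lv] =
    flatten [seq positions w v | v <- lv].
  rewrite /encode_listing -map_comp; congr flatten; apply/esym/eq_in_map => v.
  rewrite (mem_leaves k lab_bij ME) // => /and3P[/eqP sv _ _].
  exact: positions_set_of_bits.
have w_gt0 : 0 < w := leq_trans k_gt0 kw.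
have [t tT H] := @ideal_lister_outputs w k s w_gt0.
exists t => //; apply: leq_trans tT _.
have := nodes_leq lab_bij ME w0 feas; rewrite -/M -/lv N_lv => nodesN.
apply: (@leq_trans (160 * (w * w) * (3 * w * size lv))).
  rewrite leq_mul2l (leq_trans nodesN) ?orbT // leq_mul2r; lia.
by rewrite !expnS expn0; lia.
Qed.
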